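(* Let $\mathcal{X}$ be a finite set, $U:\mathcal{X}\to\mathbb{R}$ a function, and $Q$ the generator of an ergodic continuous-time Markov chain on $\mathcal{X}$ reversible with respect to its stationary distribution $\pi$. For $i=1,2$ let $X^{M_i}=(X^{M_i}_t)_{t\ge0}$ be the non-homogeneous continuous-time Markov chain with generators $(M_{i,t})_{t\ge0}$, and let $\mathbb{P}_x$ denote the law of the chain started at $x$ at time $0$. Suppose that $x\in U_{min}^{loc}$. Then, under any cooling schedule $T(t)$, $$\mathbb{P}_x(X^{M_2}_t=x\ \ \forall t\geq 0)=\lim_{t\to\infty}e^{-\left(\sum_{y\neq x}Q(x,y)\right)t}=0.$$ If moreover $\delta>0$ and the cooling schedule is $$T(t)=\frac{\delta-\epsilon}{\log(t+1)},$$ where $\epsilon>0$ is such that $\delta>\epsilon$, then $$\mathbb{P}_x(X^{M_1}_t=x\ \ \forall t\geq 0)>0.$$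
   Context: $\mathcal{X}$ has at least two points. A cooling schedule is a function $T(t)>0$ that is monotonically decreasing to $0$ as $t\to\infty$; for schedules that blow up at $t=0$, $1/T(0)$ is read as $0$. Reversibility: $\pi(x)Q(x,y)=\pi(y)Q(y,x)$ for all $x,y$. With $a_+=\max\{a,0\}$, for $x\neq y$, $$M_{1,t}(x,y)=Q(x,y)\min\{1,e^{(U(x)-U(y))/T(t)}\}=Q(x,y)e^{-(U(y)-U(x))_+/T(t)},$$ $$M_{2,t}(x,y)=Q(x,y)\max\{1,e^{(U(x)-U(y))/T(t)}\}=Q(x,y)e^{(U(x)-U(y))_+/T(t)},$$ and $M_{i,t}(x,x)=-\sum_{z\neq x}M_{i,t}(x,z)$. Further, $N(x)=\{y\in\mathcal{X}: Q(x,y)>0\}$ (neighbours of $x$), $U_{min}^{loc}=\{x\in\mathcal{X}: U(y)\geq U(x)\ \text{for all } y\in N(x)\}$, and $\delta=\min\{U(y)-U(x): x\in U_{min}^{loc},\ y\in N(x)\}$. *)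

(* Defs.v *)
From HB Require Import structures.
From mathcomp Require Import all_boot all_order all_algebra.
From mathcomp Require Import all_classical all_reals all_analysis.

Set Implicit Arguments.
Unset Strict Implicit.
Unset Printing Implicit Defensive.

Import Order.TTheory GRing.Theory Num.Theory.
Import numFieldNormedType.Exports.

Local Open Scope classical_set_scope.
Local Open Scope ring_scope.

Section Generators.
Context {R : realType} {S : finType}.
Implicit Types (Q m : S -> S -> R) (pi U : S -> R).

Definition is_generator Q : Prop :=
  (forall x y, x != y -> 0 <= Q x y) /\ (forall x, \sum_y Q x y = 0).

(* On a finite state space a continuous-time chain is ergodic (irreducible and
   positive recurrent) as soon as it is irreducible; there is no aperiodicity
   condition in continuous time. *)
Definition ergodic_generator Q : Prop :=
  is_generator Q /\ (forall x y, connect (fun a b => 0 < Q a b) x y).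

Definition stationary_distribution Q pi : Prop :=
  [/\ forall x, 0 <= pi x, \sum_x pi x = 1 & forall y, \sum_x pi x * Q x y = 0].

Definition reversible Q pi : Prop :=
  forall x y, pi x * Q x y = pi y * Q y x.

Definition neighbours Q (x : S) : set S := [set y | 0 < Q x y].

Definition Uminloc Q U : set S :=
  [set x | forall y, neighbours Q x y -> U x <= U y].

(* The infimum of a finite set, nonempty when Q is ergodic and S has at least
   two points: it is then a minimum. *)
Definition delta Q U : R :=
  inf [set r | exists x y,
    [/\ Uminloc Q U x, neighbours Q x y & r = U y - U x]].

Definition with_diagonal m (x y : S) : R :=
  if x == y then - \sum_(z | z != x) m x z else m x y.

End Generators.

Section Annealing.
Context {R : realType} {S : finType}.
Implicit Types (Q : S -> S -> R) (U : S -> R) (T : R -> \bar R).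

(* T takes extended real values so that T 0 = +oo is allowed; only its values
   at nonnegative times matter. *)
Definition cooling_schedule T : Prop :=
  [/\ forall t, 0 <= t -> (0 < T t)%E,
      forall t, 0 < t -> (T t < +oo)%E,
      forall s t, 0 <= s -> s <= t -> (T t <= T s)%E &
      T t @[t --> +oo%R] --> 0%E].

(* 1 / T(t), which is 0 when T t = +oo *)
Definition inv_temp T (t : R) : R := fine (T t)^-1%E.

Definition M1 Q U T (t : R) : S -> S -> R :=
  with_diagonal (fun x y =>
    Q x y * Num.min 1 (expR ((U x - U y) * inv_temp T t))).

Definition M2 Q U T (t : R) : S -> S -> R :=
  with_diagonal (fun x y =>
    Q x y * Num.max 1 (expR ((U x - U y) * inv_temp T t))).

(* In \bar R, c / 0 = +oo for c > 0: the value at t = 0 is +oo. *)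
Definition log_schedule (c : R) (t : R) : \bar R :=
  (c%:E / (ln (t + 1))%:E)%E.

End Annealing.

Section Chains.
Context {R : realType} {S : finType}.

(* p s t x y is the probability to be in y at time t, starting from x at time s.
   The Kolmogorov forward equation is in integral form because t |-> G t need
   not be continuous. *)
Record transition_function (G : R -> S -> S -> R)
    (p : R -> R -> S -> S -> R) : Prop := {
  transition_ge0 : forall s t x y, 0 <= s -> s <= t -> 0 <= p s t x y;
  transition_sum1 : forall s t x, 0 <= s -> s <= t -> \sum_y p s t x y = 1;
  chapman_kolmogorov : forall r s t x y, 0 <= r -> r <= s -> s <= t ->
    p r t x y = \sum_z p r s x z * p s t z y;
  forward_integrable : forall s t x y, 0 <= s -> s <= t ->
    (@lebesgue_measure R).-integrable `[s, t]
      (fun u => (\sum_z p s u x z * G u z y)%:E);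
  forward_equation : forall s t x y, 0 <= s -> s <= t ->
    p s t x y = (x == y)%:R +
      \int[@lebesgue_measure R]_(u in `[s, t]) (\sum_z p s u x z * G u z y)
}.

(* Right-continuity of the paths for the discrete topology of S makes events
   such as stays_at below measurable. *)
Record markov_chain (G : R -> S -> S -> R) (d : measure_display)
    (Om : measurableType d) (P : probability Om R) (X : R -> Om -> S) :
    Prop := {
  chain_measurable : forall t y, 0 <= t -> measurable [set w | X t w = y];
  chain_right_continuous : forall w t, 0 <= t ->
    \forall s \near t^'+, X s w = X t w;
  chain_markov : exists2 p, transition_function G p &
    forall (n : nat) (t : nat -> R) (a : nat -> S),
      0 <= t 0%N -> (forall k, (k <= n)%N -> t k <= t k.+1) ->
      P [set w | forall k, (k <= n.+1)%N -> X (t k) w = a k] =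
      (P [set w | forall k, (k <= n)%N -> X (t k) w = a k] *
        (p (t n) (t n.+1) (a n) (a n.+1))%:E)%E
}.

Definition markov_chain_from (x : S) (G : R -> S -> S -> R)
    (d : measure_display) (Om : measurableType d) (P : probability Om R)
    (X : R -> Om -> S) : Prop :=
  markov_chain G P X /\ P [set w | X 0 w = x] = 1%E.

Definition stays_at (Om : Type) (X : R -> Om -> S) (x : S) : set Om :=
  [set w | forall t, 0 <= t -> X t w = x].

End Chains.

(* Main.v *)
Require Import Defs.
From HB Require Import structures.
From mathcomp Require Import all_boot all_order all_algebra.
From mathcomp Require Import all_classical all_reals all_analysis.
From mathcomp Require Import ring lra.

Set Implicit Arguments.
Unset Strict Implicit.
Unset Printing Implicit Defensive.

Import Order.TTheory GRing.Theory Num.Theory.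
Import numFieldNormedType.Exports.

Local Open Scope classical_set_scope.
Local Open Scope ring_scope.

(** The probability of never leaving [x] is the product of the holding
    probabilities of short time steps, and the minus logarithm of a holding
    probability is, to first order, the exit rate of [x] times the length of
    the step. So the chain stays at [x] forever with positive probability
    exactly when the exit rate is integrable over time.

    Under [M2] no barrier is lowered at a local minimum: every move out of [x]
    goes up or stays level, so the factor max(1, .) is 1, and the exit rate is
    the constant q = \sum_(y != x) Q x y, which is positive by
    irreducibility. The probability of staying up to time N is then at most
    exp(- q N / 2) and tends to 0. The constant q / 2 instead of q absorbs
    the chance of leaving [x] and returning within one step, which is of
    second order because the rates are bounded on bounded time intervals.

    Under [M1] every move out of [x] climbs at least delta, so with inverse
    temperature ln(t + 1) / (delta - eps) the exit rate is at most
    q (t + 1)^-(b + 1), where b + 1 = delta / (delta - eps) > 1. This rate is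
    integrable: up to a constant it is minus the derivative of
    F(t) = K (t + 1)^-b. A one-step bound exp(F(t) - F(s)) on the holding
    probability telescopes, and exp(- F(0)) > 0 bounds the probability of
    staying forever from below.

    The discrete and the continuous picture are linked by right-continuity:
    staying at [x] forever is the intersection of the decreasing events of
    being at [x] on finite dyadic grids ([stays_at_dyadic]); the grid events
    have product probabilities by the Markov property
    ([stays_on_grid_prob]); single steps are estimated from the forward
    equation ([hold_prob_ge], [hold_prob_le]). *)

(** * Estimates on real functions *)

Section RealEstimates.
Context {R : realType}.

Local Notation mu := (@lebesgue_measure R).

Lemma Rintegral_itv_cst (s t c : R) : s <= t ->
  \int[mu]_(u in `[s, t]) c = c * (t - s).
Proof.
move=> st; rewrite Rintegral_cst//= lebesgue_measure_itv/= lte_fin.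
case: ltP => [_|ts] //=.
have -> : t = s by apply/eqP; rewrite eq_le ts st.
by rewrite subrr.
Qed.

Lemma integrable_itv_cst (s t c : R) : mu.-integrable `[s, t] (fun=> c%:E).
Proof.
apply/integrableP; split; first exact: measurable_cst.
rewrite integral_cst//= lebesgue_measure_itv/=; case: ifP => _; last first.
  by rewrite mule0.
by rewrite -EFinB -EFinM ltry.
Qed.

(** The bound on [k] places the dyadic number on the finite grid of level
    [m], whose horizon [m] grows with the resolution. *)
Lemma dyadic_above (t e : R) : 0 <= t -> 0 < e ->
  exists m k : nat, [/\ (k <= m * 2 ^ m)%N, t < k%:R * (2 ^ m)%:R^-1 &
    k%:R * (2 ^ m)%:R^-1 < t + e].
Proof.
move=> t0 e0; have ei0 : 0 < e^-1 by rewrite invr_gt0.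
have [m mgt] : exists m : nat, t + 1 + e^-1 < m%:R.
  by exists (Num.truncn (t + 1 + e^-1)).+1; exact: truncnS_gt.
have [D DE] : exists D : R, D = (2 ^ m)%:R by exists (2 ^ m)%:R.
have mD : m%:R <= D by rewrite DE ler_nat ltnW// ltn_expl.
have D0 : 0 < D by rewrite DE ltr0n expn_gt0.
have tD : 0 <= t * D by rewrite mulr_ge0// ltW.
have [k kle kgt] : exists2 k : nat, k%:R <= t * D + 1 & t * D < k%:R.
  have /andP[kle kgt] := truncn_itv tD.
  by exists (Num.truncn (t * D)).+1; rewrite -?natr1 ?lerD2r// natr1.
exists m, k; rewrite -DE; split.
- rewrite -(ler_nat R) natrM -DE; apply: (le_trans kle).
  apply: (@le_trans _ _ ((t + 1) * D)); last by rewrite ler_pM2r//; lra.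
  by rewrite mulrDl mul1r lerD2l; apply: le_trans mD; lra.
- by rewrite ltr_pdivlMr.
- apply: (@le_lt_trans _ _ (t + D^-1)).
    by rewrite ler_pdivrMr// mulrDl mulVf ?gt_eqF.
  by rewrite ltrD2l invf_plt ?posrE//; apply: lt_le_trans mD; lra.
Qed.

Lemma expR_le_1B (y : R) : 0 <= y -> y <= 2^-1 -> expR (- (2 * y)) <= 1 - y.
Proof.
move=> y0 y2; have e1 := expR_ge1Dx (2 * y).
rewrite expRN -div1r ler_pdivrMr ?expR_gt0//.
have : (1 - y) * (1 + 2 * y) <= (1 - y) * expR (2 * y) by apply: ler_wpM2l; lra.
apply: le_trans; nra.
Qed.

(** The mean value inequality for the convex function u^-b; it follows from
    1 + x <= exp x and ln x <= x - 1 without differentiating. *)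
Lemma powR_decrement (b u v : R) : 0 < b -> 0 < u -> u <= v ->
  b * v `^ (- (b + 1)) * (v - u) <= u `^ (- b) - v `^ (- b).
Proof.
move=> b0 u0 uv; have v0 : 0 < v by exact: lt_le_trans uv.
have -> : v `^ (- (b + 1)) = v `^ (- b) * v^-1.
  by rewrite opprD powRB ?(gt_eqF v0) ?implybT// powRr1// ltW.
have -> : u `^ (- b) = v `^ (- b) * (u / v) `^ (- b).
  by rewrite -powRM ?divr_ge0 ?ltW// mulrC divfK ?gt_eqF.
have uv0 : 0 < u / v by rewrite divr_gt0.
have lnuv : ln (u / v) <= u / v - 1.
  have /le_ln1Dx : - 1 < u / v - 1 by rewrite ltrBrDr addNr.
  by rewrite addrC subrK.
have : 1 + b * (1 - u / v) <= (u / v) `^ (- b).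
  rewrite /powR gt_eqF//; apply: le_trans (expR_ge1Dx _).
  by rewrite lerD2l mulNr -mulrN ler_pM2l// lerNr opprB.
move=> /(ler_wpM2l (powR_ge0 v (- b))).
have -> : b * (v `^ (- b) * v^-1) * (v - u) = v `^ (- b) * (b * (1 - u / v)).
  by field; rewrite gt_eqF.
by rewrite mulrDr mulr1; lra.
Qed.

Lemma cvg_expRN_linear (c : R) : 0 < c ->
  (expR (- c * t))%:E @[t --> +oo%R] --> 0%E.
Proof.
move=> c0; apply: cvg_EFin; first by near=> t.
under eq_cvg do rewrite /= mulNr.
apply: (@cvg_comp _ _ _ (fun t => c * t) (fun t => expR (- t)) _ +oo%R).
  exact: gt0_cvgMry.
exact: cvgr_expR.
Unshelve. all: by end_near. Qed.

End RealEstimates.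

(** * Holding probabilities over one step *)

Section HoldingProbability.
Context {R : realType} {S : finType}.
Variables (G : R -> S -> S -> R) (p : R -> R -> S -> S -> R).
Hypothesis tf : transition_function G p.

Lemma transition_le1 s t x y : 0 <= s -> s <= t -> p s t x y <= 1.
Proof.
move=> s0 st; rewrite -(transition_sum1 tf x s0 st) (bigD1 y)//= lerDl.
by apply: sumr_ge0 => z _; exact: (transition_ge0 tf).
Qed.

Lemma leave_prob_sum s t x : 0 <= s -> s <= t ->
  \sum_(z | z != x) p s t x z = 1 - p s t x x.
Proof.
move=> s0 st; have := transition_sum1 tf x s0 st; rewrite (bigD1 x)//= => <-.
by rewrite [RHS]addrAC subrr add0r.
Qed.

(** In the forward equation the inflow into [x] from the other states is
    nonnegative, and the outflow rate is at most [r]. *)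
Lemma hold_prob_ge s t x r : 0 <= s -> s <= t -> 0 <= r ->
  (forall u z, s <= u -> u <= t -> z != x -> 0 <= G u z x) ->
  (forall u, s <= u -> u <= t -> - r <= G u x x) ->
  1 - r * (t - s) <= p s t x x.
Proof.
move=> s0 st r0 Gge0 Gr.
rewrite (forward_equation tf x x s0 st) eqxx lerD2l -mulNr -Rintegral_itv_cst//.
apply: le_Rintegral => //; first exact: integrable_itv_cst.
- exact: (forward_integrable tf).
- move=> u /=; rewrite in_itv/= => /andP[su ut].
  rewrite (bigD1 x)//= -[leLHS]addr0 lerD//.
    have p1 := transition_le1 x x s0 su.
    have p0 := transition_ge0 tf x x s0 su.
    have Gux := Gr u su ut.
    nra.
  apply: sumr_ge0 => z zx; rewrite mulr_ge0 ?Gge0//.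
  exact: (transition_ge0 tf).
Qed.

(** The mass outside [x] is at most q (t - s) by the lower bound, so the
    inflow is at most C q (t - s). For a short step the net outflow rate
    therefore stays at least q / 2. *)
Lemma hold_prob_le s t x q C : 0 <= s -> s <= t -> 0 <= q -> 0 <= C ->
  (forall u z, s <= u -> u <= t -> z != x -> 0 <= G u z x <= C) ->
  (forall u, s <= u -> u <= t -> G u x x = - q) ->
  (q + C) * (t - s) <= 2^-1 ->
  p s t x x <= 1 - q / 2 * (t - s).
Proof.
move=> s0 st q0 C0 GC Gq small.
rewrite (forward_equation tf x x s0 st) eqxx lerD2l -mulNr -Rintegral_itv_cst//.
apply: le_Rintegral => //; last 2 first.
- exact: integrable_itv_cst.
- move=> u /=; rewrite in_itv/= => /andP[su ut].
  have hold : 1 - q * (u - s) <= p s u x x.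
    apply: hold_prob_ge => // [v z sv vu zx|v sv vu].
      by have /andP[] := GC v z sv (le_trans vu ut) zx.
    by rewrite Gq// (le_trans vu).
  have p1 := transition_le1 x x s0 su.
  have inflow : \sum_(z | z != x) p s u x z * G u z x <= C * (1 - p s u x x).
    rewrite -leave_prob_sum// mulr_sumr ler_sum// => z zx.
    rewrite mulrC ler_wpM2r//; first exact: (transition_ge0 tf).
    by have /andP[] := GC u z su ut zx.
  rewrite (bigD1 x)//= Gq//.
  (* the integrand is at most - q + (q + C) (1 - p s u x x), and the
     smallness of the step makes the last term at most q / 2 *)
  have ? : (q + C) * (1 - p s u x x) <= (q + C) * (q * (t - s)).
    by apply: ler_wpM2l; [exact: addr_ge0 | nra].
  have ? : q * ((q + C) * (t - s)) <= q * 2^-1 by exact: ler_wpM2l.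
  lra.
- exact: (forward_integrable tf).
Qed.

End HoldingProbability.

(** * Staying forever as a limit over grids *)

Section StayingForever.
Context {R : realType} {S : finType} {d : measure_display}.
Context {Om : measurableType d} (P : probability Om R).
Variables (X : R -> Om -> S) (G : R -> S -> S -> R) (x : S).
Hypothesis chainX : markov_chain_from x G P X.

Definition stays_on_grid (h : R) (n : nat) : set Om :=
  [set w | forall k, (k <= n)%N -> X (k%:R * h) w = x].

Lemma measurable_stays_on_grid h n : 0 <= h -> measurable (stays_on_grid h n).
Proof.
move=> h0; have [[mX _ _] _] := chainX.
have -> : stays_on_grid h n =
    \bigcap_(k in [set k | (k <= n)%N]) [set w | X (k%:R * h) w = x].
  by apply/seteqP; split.
apply: bigcap_measurable => [|k _]; first by exists 0%N.
by apply: mX; rewrite mulr_ge0.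
Qed.

Lemma stays_on_grid_prob : exists2 p, transition_function G p &
  forall h n, 0 <= h -> P (stays_on_grid h n) =
    (\prod_(k < n) p (k%:R * h) (k.+1%:R * h) x x)%:E.
Proof.
have [[_ _ [p tfp markov]] X0] := chainX; exists p => // h n h0.
elim: n => [|n IHn].
  rewrite big_ord0 -X0; congr (P _); apply/seteqP; split=> w.
    by move=> /(_ 0%N (leqnn _)); rewrite mul0r.
  by move=> Xw k; rewrite leqn0 => /eqP ->; rewrite mul0r.
rewrite big_ord_recr/= EFinM -IHn.
apply: (markov n (fun k => k%:R * h) (fun=> x)); first by rewrite mul0r.
by move=> k _; rewrite ler_wpM2r// ler_nat.
Qed.

(** The mesh 2^-m shrinks while the horizon m grows, so that a single index
    exhausts all dyadic times and the events decrease. *)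
Definition dyadic_stay m : set Om := stays_on_grid (2 ^ m)%:R^-1 (m * 2 ^ m).

Lemma dyadic_stay_nonincreasing :
  {homo dyadic_stay : n m / (n <= m)%N >-> (m <= n)%O}.
Proof.
apply/nonincreasing_seqP => m; apply/subsetPset => w stay k km.
have := stay (2 * k)%N; rewrite expnS !natrM invfM mulrACA divff ?mul1r ?pnatr_eq0//.
by apply; rewrite mulnCA leq_mul2l/= (leq_trans km)// leq_mul2r leqnSn orbT.
Qed.

(** A time [t] is approached from the right by dyadic times, where the path
    is at [x]; right-continuity gives the value at [t]. *)
Lemma stays_at_dyadic : stays_at X x = \bigcap_m dyadic_stay m.
Proof.
have [[_ rcX _] _] := chainX.
apply/seteqP; split => [w stay m _ k _|w stay].
  by apply: stay; rewrite mulr_ge0 ?invr_ge0.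
rewrite /stays_at/= => t t0; have [e /= e0 Xt] := rcX w t t0.
have [m [k [km tk ke]]] := dyadic_above t0 e0.
rewrite -(Xt (k%:R * (2 ^ m)%:R^-1))//=; first exact: stay.
by rewrite /ball/= distrC ger0_norm ?subr_ge0 ?ltW// ltrBlDl.
Qed.

Lemma measurable_stays_at : measurable (stays_at X x).
Proof.
rewrite stays_at_dyadic; apply: bigcapT_measurable => m.
by apply: measurable_stays_on_grid; rewrite invr_ge0.
Qed.

(** Multiplied along a grid, the one-step bounds telescope to
    exp (F (last time) - F 0) >= exp (- F 0), uniformly in the grid. [F] plays
    the role of the integral of the exit rate from [t] to infinity. *)
Lemma stays_at_prob_ge (F : R -> R) (h0 : R) : 0 < h0 ->
  (forall t, 0 <= t -> 0 <= F t) ->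
  (forall p s t, transition_function G p -> 0 <= s -> s <= t -> t - s <= h0 ->
    expR (F t - F s) <= p s t x x) ->
  ((expR (- F 0))%:E <= P (stays_at X x))%E.
Proof.
move=> h00 F0 Fp; rewrite stays_at_dyadic.
have cvgP : P (dyadic_stay m) @[m --> \oo] --> P (\bigcap_m dyadic_stay m).
  apply: nonincreasing_cvg_mu.
  - by rewrite (le_lt_trans (probability_le1 _ _)) ?ltry//;
      apply: measurable_stays_on_grid; rewrite invr_ge0.
  - by move=> m; apply: measurable_stays_on_grid; rewrite invr_ge0.
  - by rewrite -stays_at_dyadic; exact: measurable_stays_at.
  - exact: dyadic_stay_nonincreasing.
apply: cvge_ge cvgP; near=> m.
have [p tfp ->] := stays_on_grid_prob; last by rewrite invr_ge0.
set h : R := (2 ^ m)%:R^-1; set n := (m * 2 ^ m)%N.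
have h_ge0 : 0 <= h by rewrite invr_ge0.
have hh0 : h <= h0.
  rewrite invf_ple ?posrE ?ltr0n ?expn_gt0//.
  apply: (@le_trans _ _ m%:R); last by rewrite ler_nat ltnW// ltn_expl.
  by near: m; exact: nbhs_infty_ger.
rewrite lee_fin.
apply: (@le_trans _ _ (expR (F (n%:R * h) - F 0))).
  by rewrite ler_expR lerDr F0// mulr_ge0.
elim: n => [|n IHn]; first by rewrite mul0r subrr expR0 big_ord0.
rewrite big_ord_recr/=.
have -> : F (n.+1%:R * h) - F 0 =
    F (n%:R * h) - F 0 + (F (n.+1%:R * h) - F (n%:R * h)) by ring.
have nh : n.+1%:R * h - n%:R * h = h by rewrite -mulrBl -natr1 addrAC subrr add0r mul1r.
rewrite expRD ler_pM ?expR_ge0// Fp ?nh// ?mulr_ge0//.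
by rewrite ler_wpM2r// ler_nat.
Unshelve. all: by end_near. Qed.

(** The one-step bound may require a mesh [h0] that depends on the horizon
    [N]; a single grid with step N / n <= h0 suffices. *)
Lemma stays_at_prob_le (q N h0 : R) : 0 < h0 -> 0 <= N ->
  (forall p s t, transition_function G p ->
    0 <= s -> s <= t -> t <= N -> t - s <= h0 ->
    p s t x x <= expR (- q * (t - s))) ->
  (P (stays_at X x) <= (expR (- q * N))%:E)%E.
Proof.
move=> h00 N0 pq.
pose n := (Num.truncn (N / h0)).+1.
have ngt : N / h0 < n%:R by exact: truncnS_gt.
pose h := N / n%:R.
have h_ge0 : 0 <= h by rewrite divr_ge0.
have hh0 : h <= h0.
  rewrite ler_pdivrMr ?ltr0n// mulrC -ler_pdivrMr//; exact: ltW.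
have nh : n%:R * h = N by rewrite mulrC divfK// pnatr_eq0.
apply: (@le_trans _ _ (P (stays_on_grid h n))).
  apply: le_measure; rewrite ?inE.
  - exact: measurable_stays_at.
  - exact: measurable_stays_on_grid.
  - by move=> w stay k _; apply: stay; rewrite mulr_ge0.
have [p tfp ->//] := stays_on_grid_prob; rewrite lee_fin.
have le_prod k : (k <= n)%N ->
    \prod_(j < k) p (j%:R * h) (j.+1%:R * h) x x <= expR (- q * (k%:R * h)).
  elim: k => [|k IHk] kn; first by rewrite mul0r mulr0 expR0 big_ord0.
  have kh : k.+1%:R * h - k%:R * h = h.
    by rewrite -mulrBl -natr1 addrAC subrr add0r mul1r.
  have le_kh : k%:R * h <= k.+1%:R * h by rewrite ler_wpM2r// ler_nat.
  rewrite big_ord_recr/= [leRHS](_ : _ = expR (- q * (k%:R * h)) * expR (- q * h)); last first.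
    by rewrite -expRD -mulrDr -[X in _ + X]kh addrC subrK.
  apply: ler_pM.
  - apply: prodr_ge0 => j _; apply: (transition_ge0 tfp); rewrite ?mulr_ge0//.
    by rewrite ler_wpM2r// ler_nat.
  - by apply: (transition_ge0 tfp) => //; rewrite mulr_ge0.
  - exact/IHk/ltnW.
  - rewrite -[X in - q * X]kh; apply: pq => //.
    + by rewrite mulr_ge0.
    + by rewrite -nh ler_wpM2r// ler_nat.
    + by rewrite kh.
by rewrite -nh le_prod.
Qed.

End StayingForever.

(** * Rates of the two annealing generators *)

Section Rates.
Context {R : realType} {S : finType}.
Variables (U : S -> R) (Q : S -> S -> R).
Hypothesis genQ : is_generator Q.

(** A path from [x] to another state has a first edge; it is not a loop,
    since the diagonal of a generator is nonpositive. *)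
Lemma exit_rate_gt0 x : (2 <= #|S|)%N ->
  (forall x y, connect (fun a b => 0 < Q a b) x y) ->
  0 < \sum_(y | y != x) Q x y.
Proof.
move=> card_S conn; have [Q0 Qsum] := genQ.
have Qx_ge0 y : y != x -> 0 <= Q x y by rewrite eq_sym; exact: Q0.
have [y yx] : exists y, y != x.
  case/card_gt1P: card_S => y [z [_ _ yz]].
  by have [yx|] := eqVneq y x; [exists z; rewrite -yx eq_sym | exists y].
have /connectP[[|z w] /=] := conn x y; first by move=> _ yE; rewrite yE eqxx in yx.
move=> /andP[Qxz _] _.
have [zx|zx] := eqVneq z x.
  have := Qsum x; rewrite (bigD1 x)//= => /eqP; rewrite addr_eq0 => /eqP Qxx.
  have : 0 <= \sum_(i | i != x) Q x i by apply: sumr_ge0.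
  by move: Qxz; rewrite zx Qxx; lra.
by rewrite (bigD1 z)//= ltr_pwDl// sumr_ge0// => i /andP[ix _]; exact: Qx_ge0.
Qed.

Lemma delta_le x y : Uminloc Q U x -> neighbours Q x y ->
  delta Q U <= U y - U x.
Proof.
move=> xmin xy; apply: ge_inf; last by exists x, y.
by exists 0 => _ [a [b [amin ab ->]]]; rewrite subr_ge0 amin.
Qed.

Lemma M1_offdiag_ge0 T t z x : z != x -> 0 <= M1 Q U T t z x.
Proof.
by move=> zx; rewrite /M1 /with_diagonal (negbTE zx) mulr_ge0 ?genQ.1//.
Qed.

Lemma M1_diag_ge T t x r :
  (forall y, neighbours Q x y -> expR ((U x - U y) * inv_temp T t) <= r) ->
  - ((\sum_(y | y != x) Q x y) * r) <= M1 Q U T t x x.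
Proof.
move=> le_r; rewrite /M1 /with_diagonal eqxx lerN2 mulr_suml ler_sum// => y yx.
have := genQ.1 x y; rewrite eq_sym yx => /(_ isT).
rewrite le_eqVlt => /predU1P[<-|Qxy]; first by rewrite !mul0r.
by rewrite ler_wpM2l ?(ltW Qxy)// ge_min le_r ?orbT.
Qed.

Lemma inv_temp_ge0 T t : cooling_schedule T -> 0 <= t -> 0 <= inv_temp T t :> R.
Proof.
by move=> [T0 _ _ _] t0; rewrite fine_ge0// inve_ge0 ltW// T0.
Qed.

Lemma inv_temp_le (T : R -> \bar R) s t : cooling_schedule T ->
  0 <= s -> s <= t -> inv_temp T s <= inv_temp T t.
Proof.
move=> [T0 _ Tle _] s0 st; have t0 := le_trans s0 st.
have Vfin u : 0 <= u -> (T u)^-1%E \is a fin_num.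
  move=> u0; have Tu := T0 u u0.
  by rewrite fin_numV ?gt_eqF// (lt_trans _ Tu).
by rewrite fine_le ?Vfin// lee_pV2 ?Tle// inE ltW// T0.
Qed.

(** At t = 0 the schedule is infinite, and its inverse temperature 0 agrees
    with ln 1 / c. *)
Lemma inv_temp_log c t : 0 < c -> 0 <= t ->
  inv_temp (log_schedule c) t = ln (t + 1) / c :> R.
Proof.
move=> c0; rewrite /inv_temp /log_schedule le_eqVlt => /predU1P[<-|t0].
  by rewrite add0r ln1 mul0r inve0 gt0_muley ?lte_fin// invey.
have l0 : 0 < ln (t + 1) by rewrite ln_gt0// ltrDr.
by rewrite inver gt_eqF// -EFinM inver gt_eqF ?divr_gt0//= invf_div.
Qed.

(** From a local minimum no neighbour is lower, so the maximum in [M2] is 1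
    on every move of positive rate. *)
Lemma M2_diag_minloc T t x : Uminloc Q U x -> 0 <= inv_temp T t ->
  M2 Q U T t x x = - \sum_(y | y != x) Q x y.
Proof.
move=> xmin iT; rewrite /M2 /with_diagonal eqxx; congr (- _).
apply: eq_bigr => y yx; have := genQ.1 x y; rewrite eq_sym yx => /(_ isT).
rewrite le_eqVlt => /predU1P[<-|Qxy]; first by rewrite mul0r.
rewrite max_l ?mulr1// expR_le1 mulr_le0_ge0// subr_le0.
exact: xmin.
Qed.

(** Moves into [x] may speed up without bound as the temperature drops, but
    up to time [N] the inverse temperature is at most its value at [N]. *)
Lemma M2_offdiag_bounded (T : R -> \bar R) N x : cooling_schedule T ->
  exists2 C, 0 <= C & forall t z, 0 <= t -> t <= N -> z != x ->
    0 <= M2 Q U T t z x <= C.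
Proof.
move=> coolT.
pose c z := Q z x * Num.max 1 (expR (`|U z - U x| * inv_temp T N)).
have max1_ge0 (a : R) : 0 <= Num.max 1 a by rewrite le_max ler01.
have c_ge0 z : z != x -> 0 <= c z by move=> zx; rewrite mulr_ge0// genQ.1.
exists (\sum_(z | z != x) c z); first exact: sumr_ge0.
move=> t z t0 tN zx; rewrite /M2 /with_diagonal (negbTE zx).
have Qzx := genQ.1 z x zx; rewrite mulr_ge0//=.
rewrite (bigD1 z)//= -[leLHS]addr0 lerD//; last first.
  by apply: sumr_ge0 => i /andP[ix _]; exact: c_ge0.
rewrite ler_wpM2l// ge_max !le_max lexx/= ler_expR; apply/orP; right.
apply: (@le_trans _ _ (`|U z - U x| * inv_temp T t)).
  by rewrite ler_wpM2r ?inv_temp_ge0// ler_norm.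
by rewrite ler_wpM2l// inv_temp_le.
Qed.

End Rates.

(** * Staying at a local minimum *)

Section LocalMinimum.
Context {R : realType} {S : finType}.
Variables (U : S -> R) (Q : S -> S -> R) (x : S).
Hypothesis genQ : is_generator Q.
Hypothesis x_minloc : Uminloc Q U x.

Let q := \sum_(y | y != x) Q x y.

Hypothesis q_gt0 : 0 < q.

Lemma M2_stays_at_prob_le (T : R -> \bar R) (N : R)
    (d : measure_display) (Om : measurableType d)
    (P : probability Om R) (X : R -> Om -> S) :
  cooling_schedule T -> markov_chain_from x (M2 Q U T) P X -> 0 <= N ->
  (P (stays_at X x) <= (expR (- (q / 2) * N))%:E)%E.
Proof.
move=> coolT chainX N0.
have [C C0 MC] := M2_offdiag_bounded U genQ N x coolT.
(* the mesh for which a return to x within one step costs less than q / 2 *)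
apply: (stays_at_prob_le chainX (h0 := (2 * (q + C))^-1)) => //.
  by rewrite invr_gt0 mulr_gt0// ltr_pwDl.
move=> p s t tfp s0 st tN small.
apply: le_trans (_ : 1 - q / 2 * (t - s) <= _).
  apply: (hold_prob_le tfp s0 st (ltW q_gt0) C0).
  - by move=> u z su ut; apply: MC; [exact: le_trans su|exact: le_trans tN].
  - move=> u su ut; apply: M2_diag_minloc => //.
    by apply: inv_temp_ge0 => //; exact: le_trans su.
  - have qC : 0 < q + C by rewrite ltr_pwDl.
    by rewrite mulrC -ler_pdivlMr// -invfM.
by apply: le_trans (expR_ge1Dx _); rewrite mulNr.
Qed.

(** The exit rate at time [s] is at most q (s + 1)^-(b + 1) with b + 1 =
    delta / (delta - eps), and b K (s + 1)^-(b + 1) is minus the derivative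
    of the potential [F] below. *)
Lemma M1_stays_at_prob_gt0 (eps : R)
    (d : measure_display) (Om : measurableType d)
    (P : probability Om R) (X : R -> Om -> S) :
  0 < eps -> eps < delta Q U ->
  markov_chain_from x (M1 Q U (log_schedule (delta Q U - eps))) P X ->
  (0 < P (stays_at X x))%E.
Proof.
set D := delta Q U => eps0 eps_delta chainX.
have c0 : 0 < D - eps by rewrite subr_gt0.
pose b := eps / (D - eps); have b0 : 0 < b by exact: divr_gt0.
have bE : D / (D - eps) = b + 1 by rewrite /b; field; rewrite gt_eqF.
(* The factor 2 ^ (b + 1) pays for evaluating the power at the right end of
   a step, where 1 + t is at most doubled; the factor 2 pays for
   exp (- 2 y) <= 1 - y. *)
pose K := 2 * q * 2 `^ (b + 1) / b.
have K0 : 0 <= K by rewrite !mulr_ge0 ?invr_ge0 ?powR_ge0 ?ltW.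
pose F (t : R) := K * (t + 1) `^ (- b).
apply: (@lt_le_trans _ _ (expR (- F 0))%:E); first by rewrite lte_fin expR_gt0.
apply: (stays_at_prob_ge chainX (h0 := Num.min 1 (2 * q)^-1)).
- by rewrite lt_min ltr01 invr_gt0 mulr_gt0.
- by move=> t _; rewrite mulr_ge0 ?powR_ge0.
move=> p s t tfp s0 st; rewrite le_min => /andP[ts1 tsq].
pose r := q * (s + 1) `^ (- (b + 1)).
have s1 : 0 < s + 1 by rewrite ltr_wpDl.
have powle : (s + 1) `^ (- (b + 1)) <= 1.
  rewrite -[leRHS](powRr0 (s + 1)) ler_powR ?lerDr// oppr_le0 addr_ge0//.
  exact: ltW.
have r0 : 0 <= r by rewrite mulr_ge0 ?powR_ge0 ?ltW.
apply: le_trans (_ : 1 - r * (t - s) <= _); last first.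
  apply: (hold_prob_ge tfp) => // [u z _ _|u su ut]; first exact: M1_offdiag_ge0.
  apply: M1_diag_ge => // y xy.
  have u0 := le_trans s0 su.
  rewrite inv_temp_log// /powR gt_eqF// ler_expR.
  have gap : D <= U y - U x by exact: delta_le.
  have lnsu : ln (s + 1) <= ln (u + 1) by rewrite ler_ln ?posrE ?lerD2r// ltr_wpDl.
  have ln0 : 0 <= ln (s + 1) by rewrite ln_ge0// lerDr.
  rewrite -bE mulNr lerNr -mulNr opprB mulrAC [leRHS]mulrA.
  by rewrite ler_pM2r ?invr_gt0// ler_pM// (ltW (lt_trans eps0 eps_delta)).
apply: le_trans (_ : expR (- (2 * (r * (t - s)))) <= _); last first.
  apply: expR_le_1B; first by rewrite mulr_ge0// subr_ge0.
  apply: (@le_trans _ _ (q * (2 * q)^-1)).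
    by rewrite ler_pM ?subr_ge0// ler_piMr// ltW.
  by rewrite invfM mulrCA divff ?mulr1 ?gt_eqF.
rewrite ler_expR lerNr opprB.
have u1 : s + 1 <= t + 1 by rewrite lerD2r.
have doubling : (s + 1) `^ (- (b + 1)) <= 2 `^ (b + 1) * (t + 1) `^ (- (b + 1)).
  have t1 : 0 < t + 1 by exact: lt_le_trans u1.
  rewrite !powRN ler_pdivlMr ?powR_gt0// mulrC ler_pdivrMr ?powR_gt0//.
  rewrite -powRM ?(ltW s1)// ge0_ler_powR ?nnegrE ?(ltW t1) ?mulr_ge0 ?(ltW s1)//.
    by rewrite addr_ge0// ltW.
  lra.
have -> : F s - F t = K * ((s + 1) `^ (- b) - (t + 1) `^ (- b)).
  by rewrite mulrBr.
apply: le_trans (ler_wpM2l K0 (powR_decrement b0 s1 u1)).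
have -> : K * (b * (t + 1) `^ (- (b + 1)) * (t + 1 - (s + 1))) =
    2 * (q * (2 `^ (b + 1) * (t + 1) `^ (- (b + 1))) * (t - s)).
  by rewrite /K; field; rewrite gt_eqF.
by rewrite ler_pM2l// ler_wpM2r ?subr_ge0// ler_pM2l.
Qed.

End LocalMinimum.

Theorem theorem3p4 (R : realType) (S : finType) (U : S -> R)
    (Q : S -> S -> R) (pi : S -> R)
    (card_S : (2 <= #|S|)%N)
    (ergodic_Q : ergodic_generator Q)
    (stationary_pi : stationary_distribution Q pi)
    (reversible_Q : reversible Q pi)
    (x : S) (x_minloc : Uminloc Q U x) :
  (forall T : R -> \bar R, cooling_schedule T ->
    forall (d : measure_display) (Om : measurableType d)
      (P : probability Om R) (X : R -> Om -> S),
      markov_chain_from x (M2 Q U T) P X ->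
      ((expR (- (\sum_(y | y != x) Q x y) * t))%:E @[t --> +oo%R]
         --> P (stays_at X x)) /\
      P (stays_at X x) = 0%E) /\
  (0 < delta Q U ->
    forall eps : R, 0 < eps -> eps < delta Q U ->
    forall (d : measure_display) (Om : measurableType d)
      (P : probability Om R) (X : R -> Om -> S),
      markov_chain_from x (M1 Q U (log_schedule (delta Q U - eps))) P X ->
      (0 < P (stays_at X x))%E).
Proof.
have [genQ conn] := ergodic_Q.
have q0 := exit_rate_gt0 genQ x card_S conn.
split=> [T coolT d Om P X chainX|_ eps eps0 eps_delta d Om P X chainX].
  suff P0 : P (stays_at X x) = 0%E.
    by rewrite P0; split=> //; exact: cvg_expRN_linear.
  apply/eqP; rewrite eq_le measure_ge0 andbT.
  have q2 : 0 < (\sum_(y | y != x) Q x y) / 2 by rewrite divr_gt0.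
  apply: (cvge_ge _ (cvg_expRN_linear q2)); near=> N.
  by apply: (M2_stays_at_prob_le genQ x_minloc q0 coolT chainX).
exact: (M1_stays_at_prob_gt0 genQ x_minloc q0 eps0 eps_delta chainX).
Unshelve. all: by end_near. Qed.
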